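(* Let $q=p^n$ with $p$ prime and $n\ge 1$, and let $\theta$ be a generator of $\mathbb{F}_q^*$. Let $V\subseteq\mathbb{F}_q$ be a $t$-dimensional $\mathbb{F}_p$-affine space and let $d$ be a divisor of $q-1$. If $a\in\{0,\ldots,d-1\}$ and $V_{a(d)}$ denotes the number of nonzero $v\in V$ such that $\log_\theta v\equiv a\pmod d$, then $$V_{a(d)}=\frac{p^t}{d}+r(a,d),$$ where $|r(a,d)|<p^{n/2}$. In particular, if $p^{t-n/2}\ge d$, then $V_{a(d)}>0$.
   Context: For a generator $\theta$ of the cyclic group $\mathbb{F}_q^*$ and $a\in\mathbb{F}_q^*$, $\log_\theta a$ is the unique integer $i\in\{1,\ldots,q-1\}$ with $a=\theta^i$. A $t$-dimensional $\mathbb{F}_p$-affine space in $\mathbb{F}_q$ is a translate $v_0+W$ of a $t$-dimensional $\mathbb{F}_p$-vector subspace $W\subseteq\mathbb{F}_q$. *)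

(* Defs.v *)
From HB Require Import structures.
From mathcomp Require Import all_boot all_order all_algebra all_fingroup.
From mathcomp Require Import all_solvable all_field.

Set Implicit Arguments.
Unset Strict Implicit.
Unset Printing Implicit Defensive.
Import GRing.Theory.
Local Open Scope ring_scope.

(* [V] is a translate [v0 + W] of a [t]-dimensional ['F_p]-subspace [W] of [F];
   [pPrimeCharType charFp] is [F] itself with its ['F_p]-vector structure. *)
Definition is_affine_space (F : finFieldType) (p : nat)
    (charFp : p \in [pchar F]) (t : nat) (V : {set F}) : Prop :=
  exists (v0 : F) (W : {vspace pPrimeCharType charFp}),
    \dim W = t /\
    V = [set v0 + w | w : pPrimeCharType charFp in W] :> {set F}.

(* The value is 0 when there is no such exponent; see [dlogP]. *)
Definition dlog (F : finFieldType) (theta : {unit F}) (a : F) : nat :=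
  if [pick i : 'I_#|F| | (0 < i)%N && (a == val theta ^+ i)] is Some i
  then i else 0%N.

Definition count_dlog (F : finFieldType) (theta : {unit F}) (V : {set F})
    (a d : nat) : nat :=
  #|[set v in V | (v != 0) && (dlog theta v == a %[mod d])]|.

Lemma dlogP (F : finFieldType) (theta : {unit F}) (a : F) :
  generator [set: {unit F}] theta -> a != 0 ->
  [/\ (1 <= dlog theta a <= #|F|.-1)%N, a = val theta ^+ dlog theta a
    & forall i, (1 <= i <= #|F|.-1)%N -> a = val theta ^+ i ->
        i = dlog theta a].
Proof.
move=> gen_th nz_a.
have F_gt0 : (0 < #|F|)%N by apply/card_gt0P; exists 0.
have ord_th : #[theta]%g = #|F|.-1.
  by move/eqP: gen_th => gen_th; rewrite orderE -gen_th card_finField_unit.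
have valX k : val (theta ^+ k)%g = val theta ^+ k by exact: FinRing.val_unitX.
have ex_i : exists2 i, (1 <= i <= #|F|.-1)%N & a = val theta ^+ i.
  have Ua : a \is a GRing.unit by rewrite unitfE.
  have : FinRing.unit F Ua \in <[theta]>%g.
    by move/eqP: gen_th => <-; rewrite inE.
  case/cyclePmin=> i; rewrite ord_th => lt_i /(congr1 val) /=.
  rewrite valX => def_a.
  case: (posnP i) => [i0 | i_gt0]; last by exists i => //; rewrite i_gt0 ltnW.
  exists #|F|.-1; first by rewrite leqnn (leq_ltn_trans _ lt_i).
  by rewrite def_a i0 -ord_th -!valX expg_order.
have uniq_i i j : (1 <= i <= #|F|.-1)%N -> (1 <= j <= #|F|.-1)%N ->
    val theta ^+ i = val theta ^+ j -> i = j.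
  case: i j => [|i] [|j] //= lt_i lt_j; rewrite -!valX => /val_inj/eqP.
  rewrite eq_expg_mod_order ord_th -(addn1 i) -(addn1 j) eqn_modDr.
  by rewrite !modn_small // => /eqP->.
rewrite /dlog; case: pickP => [i /andP[i_gt0 /eqP def_a] | no_i].
  have le_i : (1 <= i <= #|F|.-1)%N.
    by rewrite i_gt0 -ltnS prednK // ltn_ord.
  split=> // j le_j def_aj; apply: uniq_i => //; by rewrite -def_aj.
case: ex_i => i /andP[i_gt0]; rewrite -ltnS prednK // => lt_i def_a.
by have := no_i (Ordinal lt_i); rewrite /= i_gt0 -def_a eqxx.
Qed.

(* Main.v *)
Require Import Defs.
From mathcomp Require Import all_boot all_order all_algebra all_fingroup.
From mathcomp Require Import all_solvable all_field.
From mathcomp Require Import reals exp.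
From mathcomp Require Import ring lra.

Set Implicit Arguments.
Unset Strict Implicit.
Unset Printing Implicit Defensive.
Import Order.TTheory GRing.Theory Num.Theory.
Local Open Scope ring_scope.

(** The proof replaces character sums by a second moment computation.
    Write q = #|F|, let C be the set of nonzero v with
    log v = a mod d, and let m = #|C| = (q - 1) / d. Fix a nonzero additive
    form lam : F -> 'F_p, so that every hyperplane of F is b^perp for some
    b != 0, under the pairing (b, x) |-> lam (b * x). The deviation

        E(b, c) = p * #{x in C : lam (b * x) = c} - m

    measures how unevenly C meets the p parallel translates of b^perp.

    - One hyperplane. Counting pairs of points of C gives
      sum_(b, c) E(b, c)^2 = p (p - 1) q m (deviation_sqr_sum). The set C is
      stable under multiplication by the group H of d-th powers, which also has
      m elements, so E(b * h, c) = E(b, c): each b != 0 contributes its share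
      m times, and sum_c E(b, c)^2 <= p (p - 1) q. As E(b, _) has mean zero,
      no single value can carry more than the fraction (p - 1) / p of that sum,
      whence |E(b, c)| <= (p - 1) sqrt q (deviation_le).

    - From hyperplanes to V = v0 + W. Summing over the orthogonal A of W, a
      point x of C lies on the hyperplane v0 + b^perp for all b in A if x is in
      V, and for exactly one b in p otherwise, because W is its own double
      orthogonal. Hence (p - 1) (#|A| #|C :&: V| - m) is the sum of the
      #|A| - 1 deviations E(b, lam (b * v0)), b in A nonzero
      (sum_deviation_orthogonal).

    The two facts give | #|A| #|C :&: V| - m | <= (#|A| - 1) sqrt q. Since
    #|A| * p ^ t = q and d * m = q - 1, dividing by #|A| bounds the error by
    1 / (#|A| d) + (1 - 1 / #|A|) sqrt q, which is less than sqrt q because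
    1 / d <= 1 < sqrt q. *)

(** * Two counting lemmas *)

(** A nonzero value of [g] generates 'F_p additively, so [g] maps [X] onto
    'F_p, and translations by elements of [X] permute the fibers. *)
Lemma card_fiber_additive (U : finZmodType) (p : nat) (X : {set U})
    (g : U -> 'F_p) :
    prime p -> zmod_closed X -> {morph g : x y / x - y} ->
    (exists2 x, x \in X & g x != 0) ->
  forall c, (p * #|[set x in X | g x == c]|)%N = #|X|.
Proof.
move=> p_pr [X0 XB] gB [x0 Xx0 gx0] c.
have g0 : g 0 = 0 by rewrite -[in LHS](subrr 0) gB subrr.
have gN x : g (- x) = - g x by rewrite -sub0r gB g0 sub0r.
have gD x y : g (x + y) = g x + g y by rewrite -[y in LHS]opprK gB gN opprK.
have XN x : x \in X -> - x \in X by move=> Xx; rewrite -sub0r XB.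
have XD x y : x \in X -> y \in X -> x + y \in X.
  by move=> Xx Xy; rewrite -[y]opprK XB // XN.
have onto e : exists2 y, y \in X & g y = e.
  exists (x0 *+ (e / g x0 : 'F_p)).
    by elim: (nat_of_ord _) => [|k IH]; rewrite ?mulr0n // mulrS XD.
  have gMn k : g (x0 *+ k) = g x0 *+ k.
    by elim: k => [|k IH]; rewrite ?mulr0n // !mulrS gD IH.
  by rewrite gMn -mulr_natr natr_Zp mulrC divfK.
have le_fib e e' :
    (#|[set x in X | g x == e]| <= #|[set x in X | g x == e']|)%N.
  have [y Xy gy] := onto (e' - e).
  rewrite -(card_imset _ (addIr y)); apply/subset_leq_card/subsetP => z.
  case/imsetP=> x; rewrite !inE => /andP[Xx /eqP gx] ->.
  by rewrite XD // gD gx gy addrC subrK /=.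
rewrite -[in RHS]sum1_card (partition_big g predT) //=.
rewrite (eq_bigr (fun=> #|[set x in X | g x == c]|)) => [|e _].
  by rewrite sum_nat_const card_Fp.
by rewrite sum1dep_card; apply/eqP; rewrite eqn_leq !le_fib.
Qed.

Lemma exchange_card (S T : finType) (A : {set S}) (B : {set T})
    (P : S -> T -> bool) :
  (\sum_(x in A) #|[set y in B | P x y]| =
   \sum_(y in B) #|[set x in A | P x y]|)%N.
Proof.
under eq_bigr do rewrite -sum1dep_card big_mkcondr.
under [in RHS]eq_bigr do rewrite -sum1dep_card big_mkcondr.
exact: exchange_big.
Qed.

(** * The pairing defined by an additive form *)

Section Pairing.

Variables (F : finFieldType) (p : nat) (lam : F -> 'F_p).
Hypotheses (p_pr : prime p) (lamB : {morph lam : x y / x - y}).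
Hypothesis lam_neq0 : exists x, lam x != 0.

Definition orthogonal (X : {set F}) : {set F} :=
  [set b | [forall x in X, lam (b * x) == 0]].

Let lam0 : lam 0 = 0.
Proof. by rewrite -[in LHS](subrr 0) lamB subrr. Qed.

Lemma orthogonalP (X : {set F}) b :
  reflect {in X, forall x, lam (b * x) = 0} (b \in orthogonal X).
Proof. by rewrite inE; apply: eqfun_inP. Qed.

Lemma orthogonal_closed (X : {set F}) : zmod_closed (orthogonal X).
Proof.
split=> [|b b' /orthogonalP Hb /orthogonalP Hb'].
  by apply/orthogonalP => x _; rewrite mul0r.
by apply/orthogonalP => x Xx; rewrite mulrBl lamB Hb // Hb' // subrr.
Qed.

Lemma card_pairing_eq (X : {set F}) (c : 'F_p) b :
    zmod_closed X -> b \notin orthogonal X ->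
  (p * #|[set x in X | lam (b * x)%R == c]|)%N = #|X|.
Proof.
move=> Xcl; rewrite inE negb_forall_in => /existsP[x /andP[Xx nz]].
apply: (card_fiber_additive (g := fun x => lam (b * x))) => //.
  by move=> y z; rewrite mulrBr lamB.
by exists x.
Qed.

Lemma card_pairing0 (X : {set F}) b : zmod_closed X ->
  (p * #|[set x in X | lam (b * x)%R == 0%R]| =
     #|X| + (b \in orthogonal X) * (p.-1 * #|X|))%N.
Proof.
move=> Xcl; case: (boolP (b \in _)) => [/orthogonalP Hb | /card_pairing_eq-> //].
  have ->: [set x in X | lam (b * x)%R == 0%R] = X.
    by apply/setP=> x; rewrite inE andb_idr // => /Hb->.
  by rewrite mul1n -mulSn prednK ?prime_gt0.
by rewrite mul0n addn0.
Qed.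

Lemma setT_closed : zmod_closed [set: F].
Proof. by split=> [|x y]; rewrite !inE. Qed.

Lemma orthogonal_setT : orthogonal setT = [set 0].
Proof.
apply/setP=> b; rewrite [RHS]inE; apply/orthogonalP/eqP => [Hb | -> x _].
  case: lam_neq0 => x; apply: contra_neq_eq => nz.
  by rewrite -(Hb (b^-1 * x)) ?inE // mulVKf.
by rewrite mul0r.
Qed.

(** Count the pairs (b, x) with x in X and lam (b * x) = 0 in two ways: by the
    forms b, which vanish on X or on one p-th of it, and by the points x, of
    which only 0 pairs trivially with all of F. *)
Lemma card_orthogonal (X : {set F}) : zmod_closed X ->
  (#|orthogonal X| * #|X|)%N = #|F|.
Proof.
move=> Xcl; have [X0 _] := Xcl.
have p1_gt0 : (0 < p.-1)%N by rewrite -subn1 subn_gt0 prime_gt1.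
have : (\sum_(b in [set: F]) p * #|[set x in X | lam (b * x)%R == 0%R]| =
        \sum_(x in X) p * #|[set b in setT | lam (x * b)%R == 0%R]|)%N.
  rewrite -!big_distrr /= exchange_card; congr (_ * _)%N.
  by apply: eq_bigr => x _; apply: eq_card => b; rewrite !inE mulrC.
rewrite (eq_bigr _ (fun b _ => card_pairing0 b Xcl)).
rewrite (eq_bigr _ (fun x _ => card_pairing0 x setT_closed)).
rewrite !big_split /= !sum_nat_const -!big_distrl /= cardsT mulnC.
move/addnI; rewrite orthogonal_setT.
have -> : (\sum_(b in X) (b \in [set 0%R]) = 1)%N.
  rewrite (bigD1 0) //= inE eqxx big1 // => x /andP[_].
  by rewrite inE => /negbTE->.
have -> : (\sum_(b in [set: F]) (b \in orthogonal X) = #|orthogonal X|)%N.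
  rewrite -sum1_card [RHS]big_mkcond; apply: eq_big => b; first by rewrite inE.
  by case: (b \in orthogonal X).
by move/eqP; rewrite mul1n mulnCA eqn_pmul2l // => /eqP.
Qed.

(** The easy inclusion is an equality because both sides have
    #|F| / #|orthogonal X| elements. *)
Lemma orthogonalK (X : {set F}) : zmod_closed X ->
  orthogonal (orthogonal X) = X.
Proof.
move=> Xcl; have [X0 _] := Xcl; apply/esym/eqP.
rewrite eqEcard; apply/andP; split.
  apply/subsetP => x Xx; apply/orthogonalP => b /orthogonalP Hb.
  by rewrite mulrC Hb.
have A0 := (orthogonal_closed X).1.
rewrite -(@leq_pmul2r #|orthogonal X|); last by apply/card_gt0P; exists 0.
rewrite card_orthogonal ?(mulnC #|X|) ?card_orthogonal //.
exact: orthogonal_closed.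
Qed.

End Pairing.

(** The other #|T| - 1 values of [E] add up to - E c, so their squares add up to
    at least E c ^ 2 / (#|T| - 1), by Cauchy-Schwarz. *)
Lemma mean0_sqr_le (R : realDomainType) (T : finType) (E : T -> R) (c : T) :
    (1 < #|T|)%N -> \sum_x E x = 0 ->
  #|T|%:R * E c ^+ 2 <= #|T|.-1%:R * \sum_x E x ^+ 2.
Proof.
move=> T_gt1 E0; set k := #|T|.-1.
have defT : #|T| = k.+1 by rewrite /k prednK // ltnW.
have k_gt0 : 0 < k%:R :> R by rewrite ltr0n -ltnS -defT.
have sumE : \sum_(x | x != c) E x = - E c.
  by move: E0; rewrite (bigD1 c) //= => /eqP; rewrite addrC addr_eq0 => /eqP.
(* a sum that vanishes in the extremal case, E constant outside c *)
have : 0 <= \sum_(x | x != c) (k%:R * E x + E c) ^+ 2.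
  by apply: sumr_ge0 => x _; apply: sqr_ge0.
under eq_bigr do rewrite sqrrD exprMn.
rewrite !big_split /= -!mulr_sumr -!mulr_suml -!mulr_sumr sumE sumr_const.
have -> : #|[pred x | x != c]| = k by rewrite /k (cardC1 c).
rewrite [\sum_x E x ^+ 2](bigD1 c) //= defT; set S := \sum_(x | _) _.
have -> : k%:R ^+ 2 * S + (k%:R * - E c * E c + k%:R * - E c * E c) +
            E c * (E c *+ k) =
          k%:R * (k%:R * S - E c ^+ 2).
  by rewrite -[E c *+ k]mulr_natr; ring.
rewrite pmulr_rge0 // -natr1; lra.
Qed.

(** * Distribution of a multiplicatively invariant set on hyperplanes *)

Section Deviation.

Variables (R : rcfType) (F : finFieldType) (p : nat) (lam : F -> 'F_p).
Hypotheses (p_pr : prime p) (lamB : {morph lam : x y / x - y}).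
Hypothesis lam_neq0 : exists x, lam x != 0.

(** Scaled by [p] compared with the difference between the actual and the
    expected number of points, so that no division occurs. *)
Definition deviation (C : {set F}) (b : F) (c : 'F_p) : R :=
  p%:R * #|[set x in C | lam (b * x) == c]|%:R - #|C|%:R.

Let p_gt0 : (0 < p)%N. Proof. exact: prime_gt0. Qed.
Let natp1 : p.-1%:R = p%:R - 1 :> R.
Proof. by rewrite -[in RHS](prednK p_gt0) -natr1 addrK. Qed.
Let lam0 : lam 0 = 0.
Proof. by rewrite -[in LHS](subrr 0) lamB subrr. Qed.

Lemma sum_card_fibers (C : {set F}) b :
  (\sum_(c : 'F_p) #|[set x in C | lam (b * x)%R == c]| = #|C|)%N.
Proof.
rewrite -[RHS]sum1_card (partition_big (fun x => lam (b * x)) predT) //=.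
by apply: eq_bigr => c _; rewrite sum1dep_card.
Qed.

Lemma deviation_sum0 C b : \sum_c deviation C b c = 0.
Proof.
rewrite sumrB -mulr_sumr -natr_sum sum_card_fibers sumr_const card_Fp //.
by rewrite mulr_natl subrr.
Qed.

Lemma deviation_mulr (C : {set F}) b h c :
  h != 0 -> {in C, forall x, h * x \in C} ->
  deviation C (b * h) c = deviation C b c.
Proof.
move=> nz_h hC; rewrite /deviation; congr (_ - _).
have defC : [set h * x | x in C] = C.
  apply/eqP; rewrite eqEcard card_imset ?leqnn ?andbT; last exact: mulfI.
  by apply/subsetP => _ /imsetP[x Cx ->]; apply: hC.
congr (_ * _%:R); rewrite -(card_imset _ (mulfI nz_h)); apply: eq_card => y.
rewrite [RHS]inE; apply/imsetP/andP => [[x] | [Cy /eqP def_c]].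
  by rewrite inE -mulrA => /andP[Cx ?] ->; rewrite hC.
move: Cy; rewrite -{1}defC => /imsetP[x Cx def_y]; exists x => //.
by rewrite inE Cx -mulrA -def_y def_c eqxx.
Qed.

(** The inner sum counts the pairs (x, y) of points of C with
    lam (b * (y - x)) = 0. This holds for every b on the diagonal, and for one b
    in p off the diagonal. *)
Lemma sum_card_fibers_sqr (C : {set F}) :
  (p * \sum_(b in [set: F]) \sum_(c : 'F_p)
         #|[set x in C | lam (b * x)%R == c]| ^ 2 =
   #|C| * (#|C| * #|F| + p.-1 * #|F|))%N.
Proof.
pose N b c := #|[set x in C | lam (b * x)%R == c]|.
have sumN2 b : (\sum_c N b c ^ 2 = \sum_(x in C) N b (lam (b * x)%R))%N.
  rewrite [RHS](partition_big (fun x => lam (b * x)) predT) //=.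
  apply: eq_bigr => c _; rewrite -mulnn {1}/N -sum1dep_card big_distrl /=.
  by apply: eq_bigr => x /andP[_ /eqP->]; rewrite mul1n.
rewrite (eq_bigr _ (fun b _ => sumN2 b)) exchange_big /= big_distrr /=.
rewrite -sum_nat_const; apply: eq_bigr => x Cx.
rewrite /N exchange_card big_distrr /=.
have fibE y : (p * #|[set b in [set: F] | lam (b * y)%R == lam (b * x)%R]| =
    #|F| + (y == x) * (p.-1 * #|F|))%N.
  have -> : [set b in [set: F] | lam (b * y) == lam (b * x)] =
            [set b in [set: F] | lam ((y - x) * b) == 0].
    by apply/setP=> b; rewrite !inE [(y - x) * b]mulrC mulrBr lamB subr_eq0.
  rewrite (card_pairing0 p_pr lamB) ?orthogonal_setT //; last exact: setT_closed.
  by rewrite inE subr_eq0 cardsT.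
rewrite (eq_bigr _ (fun y _ => fibE y)) big_split /= sum_nat_const.
rewrite (bigD1 x) //= eqxx mul1n big1 ?addn0 // => y /andP[_ /negbTE->].
by [].
Qed.

Lemma deviation_sqr_sum (C : {set F}) :
  \sum_b \sum_c deviation C b c ^+ 2 = p%:R * (p%:R - 1) * #|F|%:R * #|C|%:R.
Proof.
have sum_b b : \sum_c deviation C b c ^+ 2 =
    p%:R ^+ 2 * (\sum_c #|[set x in C | lam (b * x)%R == c]| ^ 2)%N%:R
    - p%:R * #|C|%:R ^+ 2.
  pose N c := #|[set x in C | lam (b * x)%R == c]|.
  rewrite (eq_bigr (fun c => p%:R ^+ 2 * (N c ^ 2)%:R
    - (p%:R * #|C|%:R *+ 2) * (N c)%:R + #|C|%:R ^+ 2)) => [|c _]; last first.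
    by rewrite /deviation -/(N c) natrX; ring.
  rewrite big_split sumrB /= -!mulr_sumr -!natr_sum sum_card_fibers.
  rewrite sumr_const card_Fp // -[_ *+ p]mulr_natl.
  ring.
rewrite (eq_bigr _ (fun b _ => sum_b b)) sumrB -mulr_sumr -natr_sum sumr_const.
set S := (\sum_(b | _) _)%N.
have /(congr1 (fun k => k%:R : R)) :
    (p * S = #|C| * (#|C| * #|F| + p.-1 * #|F|))%N.
  rewrite -sum_card_fibers_sqr; congr (_ * _)%N.
  by apply: eq_bigl => b; rewrite inE.
rewrite !(natrM, natrD) natp1 => pS.
have -> : p%:R ^+ 2 * S%:R = p%:R * (p%:R * S%:R) :> R by ring.
by rewrite pS -[_ *+ _]mulr_natl; ring.
Qed.

(** The orbit of [b] under the injective maps b |-> b * h consists of #|H| terms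
    equal to that of [b] in the sum of [deviation_sqr_sum], which bounds the
    term of [b] by the average. Bounding a single square by the sum over c would
    give the factor sqrt (p (p - 1)), and sqrt (p / (p - 1)) sqrt q instead of
    sqrt q in the end; [mean0_sqr_le] improves it to p - 1. *)
Lemma deviation_le (C H : {set F}) b c :
    b != 0 -> (0 < #|C| <= #|H|)%N -> 0 \notin H ->
    {in H & C, forall h x, h * x \in C} ->
  `|deviation C b c| <= (p%:R - 1) * Num.sqrt #|F|%:R.
Proof.
move=> nz_b /andP[C_gt0 leCH] H'0 HC.
have nz_h h : h \in H -> h != 0 by apply: contraTneq => ->.
pose S b := \sum_c deviation C b c ^+ 2.
have S_ge0 b' : 0 <= S b' by apply: sumr_ge0 => ? _; apply: sqr_ge0.
have leS : #|C|%:R * S b <= #|C|%:R * (p%:R * (p%:R - 1) * #|F|%:R).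
  apply: (@le_trans _ _ (\sum_(h in H) S (b * h))).
    rewrite (eq_bigr (fun=> S b)) => [|h Hh].
      by rewrite sumr_const -[leRHS]mulr_natl ler_wpM2r ?ler_nat.
    by apply: eq_bigr => e _; rewrite deviation_mulr ?nz_h // => x; apply: HC.
  rewrite [leRHS]mulrC -deviation_sqr_sum -/S.
  rewrite -(big_imset S) /= => [|x y _ _]; last exact: mulfI.
  rewrite [leLHS]big_mkcond /=; apply: ler_sum => x _.
  by case: ifP => _; rewrite ?lexx ?S_ge0.
have := mean0_sqr_le c _ (deviation_sum0 C b).
rewrite card_Fp // => /(_ (prime_gt1 p_pr)); rewrite natp1 -/(S b) => leE.
have C_gt0R : 0 < #|C|%:R :> R by rewrite ltr0n.
have p_gt0R : 0 < p%:R :> R by rewrite ltr0n.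
have p1_ge0 : 0 <= p%:R - 1 :> R by rewrite subr_ge0 ler1n.
rewrite -ler_sqr ?nnegrE ?mulr_ge0 ?sqrtr_ge0 //.
rewrite real_normK ?num_real // exprMn sqr_sqrtr //.
rewrite -(ler_pM2l p_gt0R) (le_trans leE) //.
rewrite (ler_pM2l C_gt0R) in leS.
rewrite (le_trans (ler_wpM2l p1_ge0 leS)) //.
by rewrite le_eqVlt; apply/orP; left; apply/eqP; ring.
Qed.

(** In the sum over all of A = orthogonal W, a point x of C contributes p * #|A|
    if x - v0 is in W, and #|A| otherwise since then b |-> lam (b * (x - v0)) is
    equidistributed on A; subtracting the mean leaves (p - 1) * #|A| for each
    point of the translate. The term b = 0 accounts for (p - 1) * #|C|. *)
Lemma sum_deviation_orthogonal (C W : {set F}) v0 : zmod_closed W ->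
  \sum_(b in orthogonal lam W | b != 0) deviation C b (lam (b * v0)) =
  (p%:R - 1) * (#|orthogonal lam W|%:R * #|[set x in C | x - v0 \in W]|%:R
                - #|C|%:R).
Proof.
move=> Wcl; set A := orthogonal lam W.
have Acl : zmod_closed A by apply: orthogonal_closed.
have cntE : (p * \sum_(b in A) #|[set x in C | lam (b * x)%R == lam (b * v0)%R]| =
    #|C| * #|A| + p.-1 * #|A| * #|[set x in C | (x - v0)%R \in W]|)%N.
  rewrite exchange_card big_distrr /=.
  have fibE x : (p * #|[set b in A | lam (b * x)%R == lam (b * v0)%R]| =
      #|A| + ((x - v0)%R \in W) * (p.-1 * #|A|))%N.
    have -> : [set b in A | lam (b * x) == lam (b * v0)] =
              [set b in A | lam ((x - v0) * b) == 0].
      by apply/setP=> b; rewrite !inE [(x - v0) * b]mulrC mulrBr lamB subr_eq0.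
    by rewrite (card_pairing0 p_pr lamB) // orthogonalK.
  rewrite (eq_bigr _ (fun x _ => fibE x)) big_split /= sum_nat_const.
  congr (_ + _)%N; rewrite -big_distrl /= [RHS]mulnC; congr (_ * _)%N.
  by rewrite -sum1dep_card big_mkcondr; apply: eq_bigr => x _; case: (_ \in W).
have : \sum_(b in A) deviation C b (lam (b * v0)) =
    (p%:R - 1) * #|A|%:R * #|[set x in C | x - v0 \in W]|%:R.
  rewrite sumrB -mulr_sumr -natr_sum -natrM cntE sumr_const -[_ *+ _]mulr_natl.
  by rewrite !(natrD, natrM) natp1; ring.
rewrite (bigD1 0) /=; last exact: Acl.1.
have -> : deviation C 0 (lam (0 * v0)) = (p%:R - 1) * #|C|%:R.
  rewrite /deviation mul0r lam0 mulrBl mul1r; congr (_ * _%:R - _).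
  by apply: eq_card => x; rewrite inE mul0r lam0 eqxx andbT.
by move=> E; apply: (addrI ((p%:R - 1) * #|C|%:R)); rewrite E; ring.
Qed.

Lemma card_translate_le (C H W : {set F}) v0 :
    zmod_closed W -> (0 < #|C| <= #|H|)%N -> 0 \notin H ->
    {in H & C, forall h x, h * x \in C} ->
  `|#|orthogonal lam W|%:R * #|[set x in C | x - v0 \in W]|%:R - #|C|%:R|
    <= (#|orthogonal lam W|%:R - 1) * Num.sqrt #|F|%:R :> R.
Proof.
move=> Wcl cardCH H'0 HC; set A := orthogonal lam W.
have p1_gt0 : 0 < p%:R - 1 :> R by rewrite subr_gt0 ltr1n prime_gt1.
rewrite -(ler_pM2l p1_gt0) -{1}(gtr0_norm p1_gt0) -normrM.
rewrite -sum_deviation_orthogonal // (le_trans (ler_norm_sum _ _ _)) //.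
apply: (@le_trans _ _
  (\sum_(b in A | b != 0) (p%:R - 1) * Num.sqrt #|F|%:R)).
  by apply: ler_sum => b /andP[_ nz_b]; apply: deviation_le HC.
rewrite sumr_const; have A0 : 0 \in A by case: (orthogonal_closed lamB W).
have -> : #|[pred b in A | b != 0]| = #|A :\ 0|.
  by apply: eq_card => b; rewrite !inE andbC.
have := cardsD1 0 A; rewrite A0 => ->.
rewrite -[_ *+ _]mulr_natl natrD addrAC subrr add0r mulrCA.
by rewrite le_eqVlt eqxx.
Qed.

End Deviation.

(** * Affine spaces and classes of discrete logarithms *)

Lemma exists_additive_form (F : finFieldType) (p : nat) :
    p \in [pchar F] ->
  exists2 lam : F -> 'F_p,
    {morph lam : x y / x - y} & exists x, lam x != 0.
Proof.
move=> charFp; pose E : vectType 'F_p := pPrimeCharType charFp.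
pose e := vbasis {: E}.
have [i nz_i] : exists i, coord e i (1 : F) != 0.
  apply/existsP; apply: contraTT (oner_neq0 F); rewrite negb_exists negbK.
  move=> /forallP z1; rewrite (coord_vbasis (memvf (1 : E))).
  by rewrite big1 // => i _; move: (z1 i); rewrite negbK => /eqP->; rewrite scale0r.
exists (coord e i : F -> 'F_p); last by exists 1.
exact: (linearB (coord e i)).
Qed.

Lemma affine_space_translate (F : finFieldType) (p : nat)
    (charFp : p \in [pchar F]) (t : nat) (V : {set F}) :
    is_affine_space charFp t V ->
  exists v0 (W : {set F}),
    [/\ zmod_closed W, #|W| = (p ^ t)%N & V = [set v | v - v0 \in W]].
Proof.
case=> v0 [U [dimU ->]]; exists v0, [set w : F | (w : pPrimeCharType charFp) \in U].
split.
- split=> [|x y]; rewrite !inE; first exact: mem0v.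
  exact: (@rpredB _ U).
- rewrite cardsE (card_vspace U) dimU card_Fp //.
  exact: pcharf_prime charFp.
apply/setP=> v; rewrite !inE; apply/imsetP/idP => [[w Uw ->] | Uv].
  by rewrite addrC addKr.
by exists (v - v0); rewrite // addrC subrK.
Qed.

Section LogClass.

Variables (F : finFieldType) (theta : {unit F}) (d : nat).
Hypotheses (theta_gen : generator [set: {unit F}] theta).
Hypothesis d_dvd : (d %| #|F|.-1)%N.

Definition log_class (a : nat) : {set F} :=
  [set v | (v != 0) && (dlog theta v == a %[mod d])].

(** [dlog] inverts exponentiation modulo #|F| - 1 only, hence modulo [d]
    because [d] divides #|F| - 1. *)
Lemma dlogX i : dlog theta (val theta ^+ i) = i %[mod d].
Proof.
have nz : val theta ^+ i != 0 by rewrite expf_neq0 // -unitfE (valP theta).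
have [_ def_i _] := dlogP theta_gen nz.
move: def_i; rewrite -!FinRing.val_unitX => /val_inj/eqP.
rewrite eq_expg_mod_order orderE; move/eqP: theta_gen => <-.
rewrite card_finField_unit => /eqP Ei.
by rewrite -(modn_dvdm i d_dvd) Ei modn_dvdm.
Qed.

Lemma log_class_exp a i :
  (val theta ^+ i \in log_class a) = (i == a %[mod d]).
Proof.
by rewrite inE dlogX expf_neq0 // -unitfE (valP theta).
Qed.

Lemma log_classM a b x y :
  x \in log_class a -> y \in log_class b -> x * y \in log_class (a + b).
Proof.
have nzC c z : z \in log_class c -> z != 0 by rewrite inE => /andP[].
move=> Cx Cy; have [nz_x nz_y] := (nzC _ _ Cx, nzC _ _ Cy).
have [_ def_x _] := dlogP theta_gen nz_x.
have [_ def_y _] := dlogP theta_gen nz_y.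
move: Cx Cy; rewrite def_x def_y !log_class_exp => /eqP Ex /eqP Ey.
by rewrite -exprD log_class_exp -modnDm Ex Ey modnDm.
Qed.

Let F_gt1 : (0 < #|F|.-1)%N.
Proof. by rewrite -card_finField_unit; apply/card_gt0P; exists 1%g; rewrite inE. Qed.
Let d_gt0 : (0 < d)%N. Proof. exact: dvdn_gt0 d_dvd. Qed.

(** The [d] classes partition the nonzero elements, and they are translates of
    each other in the multiplicative group, hence equinumerous. *)
Lemma card_log_class a : (d * #|log_class a|)%N = #|F|.-1.
Proof.
have le_class b c : (#|log_class b| <= #|log_class c|)%N.
  (* d - 1 plays the role of - 1 modulo d, so that e = c - b there *)
  pose e := (c + b * d.-1)%N.
  have Ee : (e + b = c %[mod d])%N.
    by rewrite /e -addnA addnC -mulnSr prednK // modnMDl.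
  have nz : val theta ^+ e != 0 by rewrite expf_neq0 // -unitfE (valP theta).
  rewrite -(card_imset _ (mulfI nz)); apply/subset_leq_card/subsetP.
  move=> _ /imsetP[x Cx ->].
  have: val theta ^+ e * x \in log_class (e + b).
    by apply: log_classM; rewrite ?log_class_exp.
  by rewrite !inE Ee.
have <- : #|[set~ (0 : F)]| = #|F|.-1 by rewrite cardsC1.
pose cls (x : F) := Ordinal (ltn_pmod (dlog theta x) d_gt0).
rewrite -[RHS]sum1_card (partition_big cls predT) //=.
rewrite (eq_bigr (fun=> #|log_class a|)) => [|b _].
  by rewrite sum_nat_const card_ord.
rewrite sum1dep_card.
have -> : #|[set x | (x \in [set~ 0]) && (cls x == b)]| = #|log_class b|.
  by apply: eq_card => x; rewrite !inE -val_eqE /= (modn_small (ltn_ord b)).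
by apply/eqP; rewrite eqn_leq !le_class.
Qed.

End LogClass.

(** * The bound *)

Lemma count_dlog_bound (R : rcfType) (F : finFieldType) (p : nat)
    (charFp : p \in [pchar F]) (theta : {unit F}) (t : nat) (V : {set F})
    (d a : nat) :
    generator [set: {unit F}] theta -> is_affine_space charFp t V ->
    (d %| #|F|.-1)%N ->
  `|(count_dlog theta V a d)%:R - p%:R ^+ t / d%:R| < Num.sqrt #|F|%:R :> R.
Proof.
move=> theta_gen /affine_space_translate[v0 [W [Wcl cardW ->]]] d_dvd.
have p_pr : prime p by exact: pcharf_prime charFp.
have [lam lamB lam_neq0] := exists_additive_form charFp.
pose C := log_class theta d a; pose H := log_class theta d 0.
have F_gt1 : (0 < #|F|.-1)%N.
  by rewrite -card_finField_unit; apply/card_gt0P; exists 1%g; rewrite inE.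
have d_gt0 : (0 < d)%N by apply: dvdn_gt0 d_dvd.
have cardC : (d * #|C|)%N = #|F|.-1 by apply: card_log_class.
have cardCH : (0 < #|C| <= #|H|)%N.
  have -> : #|H| = #|C|.
    by apply/eqP; rewrite -(eqn_pmul2l d_gt0) cardC card_log_class.
  rewrite leqnn andbT.
  by move: F_gt1; rewrite -cardC muln_gt0 => /andP[].
have H'0 : 0 \notin H by rewrite inE eqxx.
have HC : {in H & C, forall h x, h * x \in C}.
  by move=> h x Hh Cx; apply: (log_classM theta_gen d_dvd Hh Cx).
have -> : count_dlog theta [set v | v - v0 \in W] a d =
          #|[set x in C | x - v0 \in W]|.
  by apply: eq_card => x; rewrite !inE andbC.
have := card_translate_le R p_pr lamB lam_neq0 v0 Wcl cardCH H'0 HC.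
have := card_orthogonal p_pr lamB lam_neq0 Wcl; rewrite cardW.
set A := #|_|; set N := #|_|; set s := Num.sqrt _ => cardA leN.
have cardAR : A%:R * p%:R ^+ t = #|F|%:R :> R by rewrite -natrX -natrM cardA.
have cardCR : d%:R * #|C|%:R = #|F|%:R - 1 :> R.
  rewrite -natrM cardC -[#|F| in RHS]prednK -?natr1 ?addrK //.
  exact: leq_trans (leq_pred _).
have card_gt1 : (1 < #|F|)%N by case: #|F| F_gt1 => [|[]].
have s_gt1 : 1 < s by rewrite -[ltLHS]sqrtr1 ltr_sqrt ?ltr1n ?ltr0n // ltnW.
have d_ge1 : 1 <= d%:R :> R by rewrite ler1n.
have A_gt0 : 0 < A%:R :> R.
  have : (0 < A * p ^ t)%N by rewrite cardA (leq_trans F_gt1 (leq_pred _)).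
  by rewrite muln_gt0 ltr0n => /andP[].
have dA_gt0 : 0 < d%:R * A%:R :> R by rewrite mulr_gt0 // ltr0n.
(* multiplied by d * #|A|, the error is d (#|A| N - #|C|) - 1 *)
rewrite -(ltr_pM2l dA_gt0) -{1}(gtr0_norm dA_gt0) -normrM.
have -> : d%:R * A%:R * (N%:R - p%:R ^+ t / d%:R) =
          d%:R * (A%:R * N%:R - #|C|%:R) - 1 :> R.
  rewrite [d%:R * (_ - #|C|%:R)]mulrBr cardCR -cardAR; field.
  by rewrite pnatr_eq0 -lt0n.
apply: le_lt_trans (ler_normB _ _) _.
rewrite normr1 normrM (ger0_norm (ler0n _ d)).
apply: (@le_lt_trans _ _ (d%:R * ((A%:R - 1) * s) + 1)).
  by rewrite lerD2r ler_wpM2l.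
nra.
Qed.

Theorem theorem5p3 (R : realType) (p n : nat) (F : finFieldType)
    (p_prime : prime p) (n_ge1 : (1 <= n)%N) (cardF : #|F| = (p ^ n)%N)
    (theta : {unit F}) (theta_gen : generator [set: {unit F}] theta)
    (t : nat) (V : {set F})
    (V_affine : is_affine_space (card_finPcharP cardF p_prime) t V)
    (d : nat) (d_dvd : (d %| p ^ n - 1)%N)
    (a : nat) (a_lt_d : (a < d)%N) :
  (exists r : R,
      (count_dlog theta V a d)%:R = p%:R ^+ t / d%:R + r /\
      `|r| < p%:R `^ (n%:R / 2)) /\
  ((d%:R : R) <= p%:R `^ (t%:R - n%:R / 2) -> (0 < count_dlog theta V a d)%N).
Proof.
have p_ge0 : 0 <= p%:R :> R by apply: ler0n.
have p_gt0 : 0 < p%:R :> R by rewrite ltr0n prime_gt0.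
have sqrtF : p%:R `^ (n%:R / 2) = Num.sqrt #|F|%:R :> R.
  by rewrite powRrM powR_mulrn // powR12_sqrt ?exprn_ge0 // cardF natrX.
have := count_dlog_bound R a theta_gen V_affine.
rewrite cardF -subn1 => /(_ _ d_dvd); rewrite -cardF -sqrtF => bound.
split=> [|le_d].
  by exists ((count_dlog theta V a d)%:R - p%:R ^+ t / d%:R); rewrite addrC subrK.
rewrite lt0n; apply: contraTneq bound => ->; rewrite -leNgt sub0r normrN.
have d_gt0 : 0 < d%:R :> R by rewrite ltr0n (leq_ltn_trans _ a_lt_d).
rewrite ger0_norm ?divr_ge0 ?exprn_ge0 //.
rewrite ler_pdivlMr // mulrC -powR_mulrn //.
rewrite (le_trans (ler_wpM2r _ le_d)) ?powR_ge0 //.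
by rewrite -powRD ?subrK // (gt_eqF p_gt0) implybT.
Qed.
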